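(* Let $G$ be a strongly connected digraph with $N>2$ nodes in which all nodes run the Privacy-Preserving Push-Sum Algorithm described in the context. Let $\mathcal A\subset\mathcal V$ be a set of honest-but-curious nodes and $i\notin\mathcal A$. If $N_i^{out}\cup N_i^{in}\subseteq\mathcal A$, then the initial value $x_i(0)$ can be uniquely inferred by $\mathcal A$ in an asymptotic sense: there exist quantities $\hat x_i(k)$, each computable from the information sequence $\mathcal I_{\mathcal A}(0:k)$, such that $\hat x_i(k)\to x_i(0)$ as $k\to\infty$ with probability one.
   Context: Digraph conventions: $\mathcal V=\{1,\dots,N\}$, no self-loops; $(j,i)\in\mathcal E$ means node $i$ can send messages to node $j$. $N_i^{in}=\{j:(i,j)\in\mathcal E\}$, $N_i^{out}=\{j:(j,i)\in\mathcal E\}$. Strongly connected: a directed path exists from any node to any other node. Privacy-Preserving Push-Sum Algorithm (each node $i$ has a private real initial state $x_i(0)$; $M>0$ is a fixed constant). Initialization: node $i$ draws $x^\alpha_{i,1}(0)\sim U(-M,M)$ and sets $x^\beta_{i,1}(0)=2x_i(0)-x^\alpha_{i,1}(0)$, $x^\alpha_{i,2}(0)=0$, $x^\beta_{i,2}(0)=2$. Weights: at $k=0$, node $i$ draws the numbers $\{p_{ji}(0):j\in N_i^{out}\cup\{i\}\}$ and $\alpha_i(0)$ independently from $\mathcal N(0,M)$ and normalizes them so that $\sum_{j=1}^N p_{ji}(0)+\alpha_i(0)=1$; at each $k\ge1$, node $i$ draws $\{p_{ji}(k):j\in N_i^{out}\cup\{i\}\}$ and $\alpha_i(k)$ independently from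 $U(0,1)$ and normalizes them so that $\sum_{j=1}^N p_{ji}(k)+\alpha_i(k)=1$; in all cases $p_{ji}(k)=0$ if $j\notin N_i^{out}\cup\{i\}$. State update, for $k\ge0$, $l=1,2$: node $i$ sends $p_{ji}(k)x^\alpha_{i,l}(k)$ to each $j\in N_i^{out}$ and updates $$x^\alpha_{i,l}(k+1)=\sum_{j\in N_i^{in}\cup\{i\}}p_{ij}(k)x^\alpha_{j,l}(k)+x^\beta_{i,l}(k),\qquad x^\beta_{i,l}(k+1)=\alpha_i(k)x^\alpha_{i,l}(k).$$ Node $i$'s estimated average is $\hat x^{ave}_i(k+1)=x^\alpha_{i,1}(k+1)/x^\alpha_{i,2}(k+1)$. The substate $x^\beta_{i,l}$ is never transmitted. Honest-but-curious nodes: nodes that follow the protocol (and know it), try to infer other nodes' private initial values from the data they receive, and may pool their data. For a set $\mathcal A$ of such nodes, the information available at time $k$ is $\mathcal I_{\mathcal A}(k)=\{\mathcal I_a(k):a\in\mathcal A\}$ with $$\mathcal I_a(k)=\{x^\alpha_{a,l}(k),x^\beta_{a,l}(k),p_{ja}(k),p_{ap}(k)x^\alpha_{p,l}(k): p\in N_a^{in},\ j\in\mathcal V,\ l=1,2\},$$ and $\mathcal I_{\mathcal A}(0:\kappa)=\bigcup_{0\le k\le\kappa}\mathcal I_{\mathcal A}(k)$. *)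

(* Defs.v *)
From HB Require Import structures.
From mathcomp Require Import all_boot all_order all_algebra.
From mathcomp Require Import all_classical all_reals all_analysis.
From Stdlib Require Lists.List.
Set Implicit Arguments. Unset Strict Implicit. Unset Printing Implicit Defensive.
Import Order.TTheory GRing.Theory Num.Theory.
Import numFieldNormedType.Exports.
Local Open Scope classical_set_scope.
Local Open Scope ring_scope.

(* Digraphs on V = 'I_N.  [E i j] means (i,j) \in E, i.e. node j can  *)
(* send messages to node i.                                           *)

Definition Nin (N : nat) (E : rel 'I_N) (i : 'I_N) : {set 'I_N} := [set j | E i j].
Definition Nout (N : nat) (E : rel 'I_N) (i : 'I_N) : {set 'I_N} := [set j | E j i].

Definition no_self_loops (N : nat) (E : rel 'I_N) : Prop := forall i, ~~ E i i.

(* strongly connected: a directed path from any node to any other node.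
   A message edge goes from j to i iff E i j, so "j can reach i" is
   connect (fun a b => E b a) j i. *)
Definition strongly_connected (N : nat) (E : rel 'I_N) : Prop :=
  forall u v : 'I_N, connect (fun a b => E b a) u v.

(* p k j i = p_{ji}(k),  alpha k i = alpha_i(k).                       *)
(* State at time k: (x^alpha_{.,l}(k), x^beta_{.,l}(k)).              *)
Fixpoint pps_state (R : realType) (N : nat) (E : rel 'I_N)
    (p : nat -> 'I_N -> 'I_N -> R) (alpha : nat -> 'I_N -> R)
    (a0 b0 : 'I_N -> R) (k : nat) : ('I_N -> R) * ('I_N -> R) :=
  match k with
  | 0 => (a0, b0)
  | k'.+1 =>
      let: (a, b) := pps_state E p alpha a0 b0 k' in
      (fun i => \sum_(j in Nin E i :|: [set i]) p k' i j * a j + b i,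
       fun i => alpha k' i * a i)
  end.

(* normalisation of the raw draws: q k j i (j \in N_i^out \cup {i}) and
   r k i are the raw numbers drawn by node i at time k *)
Definition pps_norm (R : realType) (N : nat) (E : rel 'I_N)
    (q : nat -> 'I_N -> 'I_N -> R) (r : nat -> 'I_N -> R) (k : nat) (i : 'I_N) : R :=
  \sum_(j in Nout E i :|: [set i]) q k j i + r k i.

Definition pps_p (R : realType) (N : nat) (E : rel 'I_N)
    (q : nat -> 'I_N -> 'I_N -> R) (r : nat -> 'I_N -> R) (k : nat) (j i : 'I_N) : R :=
  if j \in Nout E i :|: [set i] then q k j i / pps_norm E q r k i else 0.

Definition pps_alpha (R : realType) (N : nat) (E : rel 'I_N)
    (q : nat -> 'I_N -> 'I_N -> R) (r : nat -> 'I_N -> R) (k : nat) (i : 'I_N) : R :=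
  r k i / pps_norm E q r k i.

(* states for l = 1 (initialised with u = x^alpha_{.,1}(0)) and l = 2 *)
Definition pps_state1 (R : realType) (N : nat) (E : rel 'I_N) (x0 u : 'I_N -> R)
    (q : nat -> 'I_N -> 'I_N -> R) (r : nat -> 'I_N -> R) (k : nat) :=
  pps_state E (pps_p E q r) (pps_alpha E q r) u (fun i => 2 * x0 i - u i) k.

Definition pps_state2 (R : realType) (N : nat) (E : rel 'I_N)
    (q : nat -> 'I_N -> 'I_N -> R) (r : nat -> 'I_N -> R) (k : nat) :=
  pps_state E (pps_p E q r) (pps_alpha E q r) (fun=> 0) (fun=> 2) k.

(* Information I_a(k) of node a at time k:                              *)
(*  - x^alpha_{a,1}(k), x^alpha_{a,2}(k), x^beta_{a,1}(k), x^beta_{a,2}(k) *)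
(*  - p_{ja}(k) for all j                                              *)
(*  - for p \in N_a^in : Some (p_{ap}(k) x^alpha_{p,1}(k),              *)
(*                             p_{ap}(k) x^alpha_{p,2}(k)), else None   *)
Definition pps_info (R : realType) (N : nat) : Type :=
  (R * R * R * R) * {ffun 'I_N -> R} * {ffun 'I_N -> option (R * R)}.

Definition pps_obs (R : realType) (N : nat) (E : rel 'I_N) (x0 u : 'I_N -> R)
    (q : nat -> 'I_N -> 'I_N -> R) (r : nat -> 'I_N -> R)
    (a : 'I_N) (k : nat) : pps_info R N :=
  let s1 := pps_state1 E x0 u q r k in
  let s2 := pps_state2 E q r k in
  ((s1.1 a, s2.1 a, s1.2 a, s2.2 a),
   [ffun j => pps_p E q r k j a],
   [ffun p => if p \in Nin E a
              then Some (pps_p E q r k a p * s1.1 p, pps_p E q r k a p * s2.1 p)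
              else None]).

Definition depends_only_on_info (R : realType) (N : nat) (A : {set 'I_N}) (k : nat)
    (F : ('I_N -> nat -> pps_info R N) -> R) : Prop :=
  forall o o' : 'I_N -> nat -> pps_info R N,
    (forall a t, a \in A -> (t <= k)%N -> o a t = o' a t) -> F o = F o'.

Definition has_density (R : realType) (d : measure_display) (T : measurableType d)
    (P : probability T R) (X : T -> R) (f : R -> R) : Prop :=
  forall B : set R, measurable B ->
    P (X @^-1` B) = (\int[lebesgue_measure]_(x in B) (f x)%:E)%E.

Definition mutually_independent (R : realType) (d : measure_display)
    (T : measurableType d) (P : probability T R) (I : Type) (D : set I)
    (X : I -> T -> R) : Prop :=
  (forall i, D i -> measurable_fun setT (X i)) /\
  forall (J : seq I) (B : I -> set R),
    (forall j, Stdlib.Lists.List.In j J -> D j) -> Stdlib.Lists.List.NoDup J ->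
    (forall j, measurable (B j)) ->
    P (\bigcap_(j in [set j | Stdlib.Lists.List.In j J]) (X j @^-1` B j)) =
      (\prod_(j <- J) P (X j @^-1` B j))%E.

Inductive pps_draw (N : nat) : Type :=
| DrawU of 'I_N                 (* x^alpha_{i,1}(0) *)
| DrawQ of nat & 'I_N & 'I_N    (* DrawQ k j i : raw p_{ji}(k) *)
| DrawA of nat & 'I_N.          (* DrawA k i : raw alpha_i(k) *)

Definition pps_draw_dom (N : nat) (E : rel 'I_N) : set (pps_draw N) :=
  fun t => match t with
           | DrawQ _ j i => j \in Nout E i :|: [set i]
           | _ => True
           end.

Definition pps_draw_fam (R : realType) (N : nat) (T : Type) (u : 'I_N -> T -> R)
    (q : nat -> 'I_N -> 'I_N -> T -> R) (r : nat -> 'I_N -> T -> R) :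
    pps_draw N -> T -> R :=
  fun t => match t with
           | DrawU i => u i
           | DrawQ k j i => q k j i
           | DrawA k i => r k i
           end.

(* The probabilistic model of the Privacy-Preserving Push-Sum algorithm:
   x^alpha_{i,1}(0) ~ U(-M,M); at k = 0 the raw weights ~ N(0,M)
   (variance M); at k >= 1 the raw weights ~ U(0,1); all draws mutually
   independent. *)
Definition pps_model (R : realType) (d : measure_display) (T : measurableType d)
    (P : probability T R) (N : nat) (E : rel 'I_N) (M : R)
    (u : 'I_N -> T -> R) (q : nat -> 'I_N -> 'I_N -> T -> R)
    (r : nat -> 'I_N -> T -> R) : Prop :=
  [/\ (forall i, has_density P (u i) (uniform_pdf (- M) M)),
      (forall i j, j \in Nout E i :|: [set i] ->
        has_density P (q 0%N j i) (normal_pdf 0 (Num.sqrt M))) /\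
      (forall i, has_density P (r 0%N i) (normal_pdf 0 (Num.sqrt M))),
      (forall k i j, (0 < k)%N -> j \in Nout E i :|: [set i] ->
        has_density P (q k j i) (uniform_pdf 0 1)),
      (forall k i, (0 < k)%N -> has_density P (r k i) (uniform_pdf 0 1))
    & mutually_independent P (pps_draw_dom E) (pps_draw_fam u q r)].

(* Main.v *)
(* For l = 1, 2 let z_l(t) be the total mass x^alpha_{i,l}(t) + x^beta_{i,l}(t)
   of node i.  All the traffic of node i goes through A, so A knows
   z_l(t) - z_l(0), hence z_2(t) itself and z_1(t) up to the unknown
   z_1(0) = 2 x_i(0).  Any out-neighbour of i also sees the ratio
   rho(t) = x^alpha_{i,1}(t) / x^alpha_{i,2}(t).  Since x^beta_{i,l}(t) is a
   multiple of x^alpha_{i,l}(t-1) not depending on l, the mass z_1(t) lies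
   between rho(t) z_2(t) and rho(t-1) z_2(t); so at each time A confines x_i(0)
   to an interval of known width |z_2(t) (rho(t) - rho(t-1))|, and it keeps the
   narrowest one.  No consensus result is needed: for every e > 0, almost surely
   there are two consecutive steps at which all weight matrices are within
   O(e) of the identity (second Borel-Cantelli argument), and this makes the
   width O(e).  The normal draws of time 0 only matter through the fact that
   they almost surely do not sum to 0. *)
Require Import Defs.
From HB Require Import structures.
From mathcomp Require Import all_boot all_order all_algebra.
From mathcomp Require Import all_classical all_reals all_analysis.
From mathcomp Require Import measurable_realfun ring lra.
Import Order.TTheory GRing.Theory Num.Theory.
Import numFieldNormedType.Exports.
Local Open Scope classical_set_scope.
Local Open Scope ring_scope.

(* When all nodes draw almost identity weights at two consecutive steps, node
   i's mass hardly moves, which forces its ratio to stay almost constant. *)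
Definition calm {R : realType} {N : nat} (E : rel 'I_N)
    (q : nat -> 'I_N -> 'I_N -> R) (r : nat -> 'I_N -> R) (e : R) (k : nat) :=
  forall i,
  [/\ 2^-1 <= q k i i, r k i <= e & forall j, j \in Nout E i -> q k j i <= e].

(** * Mass balance and domination for the push-sum recursion with arbitrary weights *)

Section Dynamics.
Context {R : realType} {N : nat} {E : rel 'I_N}.
Hypothesis irrE : no_self_loops E.

Lemma Nout_self i : i \in Nout E i = false.
Proof. by rewrite inE; exact/negbTE/irrE. Qed.

Lemma Nin_self i : i \in Nin E i = false.
Proof. by rewrite inE; exact/negbTE/irrE. Qed.

Lemma big_Nout (F : 'I_N -> R) i :
  \sum_(j in Nout E i :|: [set i]) F j = F i + \sum_(j in Nout E i) F j.
Proof. by rewrite finset.setUC big_setU1 ?Nout_self. Qed.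

Lemma big_Nin (F : 'I_N -> R) i :
  \sum_(j in Nin E i :|: [set i]) F j = F i + \sum_(j in Nin E i) F j.
Proof. by rewrite finset.setUC big_setU1 ?Nin_self. Qed.

Lemma mem_Nin_Nout i j :
  (j \in Nin E i :|: [set i]) = (i \in Nout E j :|: [set j]).
Proof. by rewrite !inE eq_sym. Qed.

Section State.
Variables (p : nat -> 'I_N -> 'I_N -> R) (alpha : nat -> 'I_N -> R).
Variables (a0 b0 : 'I_N -> R).
Let s := pps_state E p alpha a0 b0.
Let outw k i := \sum_(j in Nout E i :|: [set i]) p k j i + alpha k i.

Lemma pps_stateS1 k i : (s k.+1).1 i =
  \sum_(j in Nin E i :|: [set i]) p k i j * (s k).1 j + (s k).2 i.
Proof. by rewrite /s /=; case: pps_state. Qed.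

Lemma pps_stateS2 k i : (s k.+1).2 i = alpha k i * (s k).1 i.
Proof. by rewrite /s /=; case: pps_state. Qed.

Lemma pps_balance k i : outw k i * (s k).1 i = (s k).1 i ->
  (s k.+1).1 i + (s k.+1).2 i = (s k).1 i + (s k).2 i +
    (\sum_(j in Nin E i) p k i j * (s k).1 j -
     \sum_(j in Nout E i) p k j i * (s k).1 i).
Proof.
rewrite /outw pps_stateS1 pps_stateS2 big_Nout big_Nin -mulr_suml => h.
by rewrite -[in X in _ = X + _ + _]h; ring.
Qed.

(** Column-stochasticity is assumed only after multiplication by the state. At time 0 with l = 2 the
    states x^alpha vanish, so the condition then holds even where a normalising sum is 0. *)
Lemma pps_total k : (forall i, outw k i * (s k).1 i = (s k).1 i) ->
  \sum_i ((s k.+1).1 i + (s k.+1).2 i) = \sum_i ((s k).1 i + (s k).2 i).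
Proof.
move=> h.
under eq_bigr do rewrite pps_stateS1 pps_stateS2.
rewrite !big_split /=.
rewrite -addrA addrCA addrC; congr (_ + _).
rewrite (exchange_big_dep predT) //= -big_split /=.
apply: eq_bigr => j _; rewrite -[RHS]h /outw mulrDl mulr_suml.
by congr (_ + _); apply: eq_bigl => i; rewrite mem_Nin_Nout.
Qed.

End State.

(** Both runs follow the same linear update with nonnegative coefficients, so the triangle
    inequality carries the bounds over with the same [K]. *)
Lemma pps_state_dominated p alpha a0 b0 a0' b0' (K : R) k :
  let s := pps_state E p alpha a0 b0 in
  let s' := pps_state E p alpha a0' b0' in
  (forall i j, 0 <= p k i j) -> (forall i, 0 <= alpha k i) ->
  (forall i, `|(s k).1 i| <= K * (s' k).1 i) ->
  (forall i, `|(s k).2 i| <= K * (s' k).2 i) ->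
  (forall i, `|(s k.+1).1 i| <= K * (s' k.+1).1 i) /\
  (forall i, `|(s k.+1).2 i| <= K * (s' k.+1).2 i).
Proof.
move=> s s' p0 al0 h1 h2; split => i; rewrite /s /s' ?pps_stateS1 ?pps_stateS2.
- rewrite mulrDr (le_trans (ler_normD _ _))// lerD// mulr_sumr.
  rewrite (le_trans (ler_norm_sum _ _ _))// ler_sum// => j _.
  by rewrite normrM ger0_norm// mulrCA ler_wpM2l.
- by rewrite normrM ger0_norm// mulrCA ler_wpM2l.
Qed.

(** * Runs with positive draws from time 1 on: bounded ratios, and the effect of calm steps *)

Section Run.
Context {x0 u : 'I_N -> R}.
Context {q : nat -> 'I_N -> 'I_N -> R} {r : nat -> 'I_N -> R}.
Let p := pps_p E q r.
Let al := pps_alpha E q r.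
Let nrm := pps_norm E q r.
Let s1 := pps_state1 E x0 u q r.
Let s2 := pps_state2 E q r.

Lemma pps_weights_sum k i : nrm k i != 0 ->
  \sum_(j in Nout E i :|: [set i]) p k j i + al k i = 1.
Proof.
move=> n0; rewrite /p /al /pps_p /pps_alpha.
under eq_bigr => j -> do rewrite -/nrm.
by rewrite -mulr_suml -mulrDl divff.
Qed.

Hypothesis qpos : forall k j i, (0 < k)%N ->
  j \in Nout E i :|: [set i] -> 0 < q k j i.
Hypothesis rpos : forall k i, (0 < k)%N -> 0 < r k i.

Lemma pps_norm_gt0 k i : (0 < k)%N -> 0 < nrm k i.
Proof.
move=> k0; rewrite /nrm /pps_norm ltr_wpDl ?rpos// sumr_ge0// => j ji.
exact/ltW/qpos.
Qed.

Lemma pps_p_gt0 k j i : (0 < k)%N -> j \in Nout E i :|: [set i] -> 0 < p k j i.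
Proof. by move=> k0 ji; rewrite /p /pps_p ji divr_gt0 ?qpos ?pps_norm_gt0. Qed.

Lemma pps_p_ge0 k j i : (0 < k)%N -> 0 <= p k j i.
Proof.
move=> k0; case: (boolP (j \in Nout E i :|: [set i])) => ji.
  exact/ltW/pps_p_gt0.
by rewrite /p /pps_p (negbTE ji).
Qed.

Lemma pps_alpha_gt0 k i : (0 < k)%N -> 0 < al k i.
Proof. by move=> k0; rewrite divr_gt0 ?rpos ?pps_norm_gt0. Qed.

(** The weights of time 0, which may have any sign, are applied to zero states when l = 2. The l = 2
    run thus starts afresh at time 1 with known positive values. *)
Lemma pps_state2_1 i : (s2 1).1 i = 2.
Proof.
by rewrite /s2 /pps_state2 pps_stateS1 /= big1 ?add0r// => j _; rewrite mulr0.
Qed.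

Lemma pps_state2_ge0 k : (forall i, 0 < (s2 k.+1).1 i) /\
  (forall i, 0 <= (s2 k.+1).2 i).
Proof.
elim: k => [|k [IH1 IH2]].
  split=> i; first by rewrite pps_state2_1.
  by rewrite /s2 /pps_state2 pps_stateS2 /= mulr0.
split => i; last first.
  by rewrite /s2 /pps_state2 pps_stateS2 mulr_ge0 ?ltW ?pps_alpha_gt0.
rewrite /s2 /pps_state2 pps_stateS1 big_Nin ltr_wpDr// ltr_wpDr//.
  by apply: sumr_ge0 => j _; rewrite mulr_ge0 ?pps_p_ge0// ltW// IH1.
by rewrite mulr_gt0 ?pps_p_gt0 ?IH1// !inE eqxx orbT.
Qed.

Lemma pps_state2_total k : \sum_i ((s2 k).1 i + (s2 k).2 i) = (2 * N)%:R.
Proof.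
elim: k => [|k <-]; last first.
  apply: pps_total => i; case: k => [|k]; first by rewrite /= mulr0.
  by rewrite pps_weights_sum ?mul1r// gt_eqF ?pps_norm_gt0.
rewrite /= (eq_bigr (fun=> 2)) => [|i _]; last by rewrite add0r.
by rewrite sumr_const card_ord natrM mulr_natr.
Qed.

Lemma pps_state2_le k i : (s2 k.+1).1 i <= (2 * N)%:R.
Proof.
have [h1 h2] := pps_state2_ge0 k; rewrite -(pps_state2_total k.+1) (bigD1 i)//=.
rewrite -addrA lerDl addr_ge0// sumr_ge0// => j _.
by rewrite addr_ge0// ltW.
Qed.

(** Since x^beta_{i,2}(1) = 0, time 2 is the first at which both l = 2 substates are positive. The
    sum of all ratios at that time, plus 1, serves as [K], and [pps_state_dominated] propagates
    it. *)
Lemma pps_ratio_bounded : exists2 K : R, 0 < K & forall k,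
  (forall i, `|(s1 k.+2).1 i| <= K * (s2 k.+2).1 i) /\
  (forall i, `|(s1 k.+2).2 i| <= K * (s2 k.+2).2 i).
Proof.
have a0 i : 0 < (s2 2).1 i by have [] := pps_state2_ge0 1.
have b0 i : 0 < (s2 2).2 i.
  by rewrite /s2 /pps_state2 pps_stateS2 mulr_gt0 ?pps_alpha_gt0// pps_state2_1.
pose f i := `|(s1 2).1 i| / (s2 2).1 i; pose g i := `|(s1 2).2 i| / (s2 2).2 i.
have f0 i : 0 <= f i by rewrite divr_ge0// ltW.
have g0 i : 0 <= g i by rewrite divr_ge0// ltW.
have le i : f i + g i <= \sum_i (f i + g i) + 1.
  rewrite (bigD1 i)//= -addrA lerDl addr_ge0// sumr_ge0// => j _.
  exact: addr_ge0.
exists (\sum_i (f i + g i) + 1).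
  by rewrite ltr_wpDl// sumr_ge0// => j _; rewrite addr_ge0.
elim=> [|k [IH1 IH2]].
  split=> i; rewrite -ler_pdivrMr//; apply: (le_trans _ (le i)).
    by rewrite -/(f i) lerDl.
  by rewrite -/(g i) lerDr.
apply: pps_state_dominated => // *; [exact: pps_p_ge0|exact/ltW/pps_alpha_gt0].
Qed.

(** The raw self-weight alone makes the normalising sum at least 1/2, so normalisation at most
    doubles a small draw. *)
Lemma calm_weights e k i : (0 < k)%N -> calm E q r e k ->
  al k i <= 2 * e /\ forall j, j \in Nout E i -> p k j i <= 2 * e.
Proof.
move=> k0 /(_ i)[qi ri qj].
have n2 : 2^-1 <= nrm k i.
  rewrite /nrm /pps_norm big_Nout (le_trans qi)// -addrA lerDl addr_ge0//.
    by apply: sumr_ge0 => j ji; rewrite ltW// qpos// inE ji.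
  exact/ltW/rpos.
have e0 : 0 <= e by rewrite (le_trans _ ri)// ltW ?rpos.
have aux y : y <= e -> y / nrm k i <= 2 * e.
  move=> ye; rewrite ler_pdivrMr ?pps_norm_gt0// (le_trans ye)//.
  rewrite -[leLHS]mulr1 mulrAC mulrC ler_wpM2r//.
  by rewrite -(ler_pM2l (_ : 0 < 2 :> R))// mulfV// in n2.
split; first exact: aux.
by move=> j ji; rewrite /p /pps_p inE ji /=; apply: aux; apply: qj.
Qed.

Let ratio i k := (s1 k).1 i / (s2 k).1 i.

Lemma calm_ratio : exists2 K : R, 0 < K & forall e k i,
  calm E q r e k.+1 -> calm E q r e k.+2 ->
  `|((s2 k.+3).1 i + (s2 k.+3).2 i) * (ratio i k.+3 - ratio i k.+2)| <= K * e.
Proof.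
have [K K0 HK] := pps_ratio_bounded.
(* Six error terms of size K X will appear, with X = 2 e (2 N); the summand 1 only keeps the
   constant positive. *)
exists (12 * K * (2 * N)%:R + 1) => [|e k i c1 c2].
  by rewrite ltr_wpDl// !mulr_ge0// ltW.
have [a0 b0] := pps_state2_ge0 k.+1; have [a0' b0'] := pps_state2_ge0 k.+2.
have [a0'' _] := pps_state2_ge0 k.
have [A1 B1] := HK k; have [A2 B2] := HK k.+1.
have rK k' : (forall i, `|(s1 k'.+2).1 i| <= K * (s2 k'.+2).1 i) ->
    `|ratio i k'.+2| <= K.
  move=> h; have [h0 _] := pps_state2_ge0 k'.+1.
  by rewrite normrM normfV (gtr0_norm (h0 i)) ler_pdivrMr.
have e0 : 0 < e by have [_ /(lt_le_trans _)->] := c1 i; rewrite ?rpos.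
(* This substate carries the weight alpha_i of the preceding step, which is where the first of the
   two calm steps enters. *)
have al1 : (s2 k.+2).2 i <= 2 * e * (2 * N)%:R.
  rewrite {1}/s2 /pps_state2 pps_stateS2.
  have [h _] := calm_weights _ _ i (ltn0Sn k) c1.
  by rewrite ler_pM ?pps_state2_le// ltW// pps_alpha_gt0.
have al2 : (s2 k.+3).2 i <= 2 * e * (2 * N)%:R.
  rewrite {1}/s2 /pps_state2 pps_stateS2.
  have [h _] := calm_weights _ _ i (ltn0Sn k.+1) c2.
  by rewrite ler_pM ?pps_state2_le// ltW// pps_alpha_gt0.
pose infl (s : nat -> ('I_N -> R) * ('I_N -> R)) :=
  \sum_(j in Nin E i) p k.+2 i j * (s k.+2).1 j.
have in2 : infl s2 <= 2 * e * (2 * N)%:R.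
  apply: (@le_trans _ _ (\sum_j 2 * e * ((s2 k.+2).1 j + (s2 k.+2).2 j))).
    rewrite /infl big_mkcond ler_sum// => j _.
    case: ifPn => ji; last by rewrite !mulr_ge0 ?addr_ge0// ltW.
    have [_ h] := calm_weights _ _ j (ltn0Sn k.+1) c2.
    rewrite ler_pM// ?lerDl//; [exact: pps_p_ge0|exact: ltW|].
    by apply: h; move: ji; rewrite !inE.
  by rewrite -mulr_sumr pps_state2_total.
have in1 : `|infl s1| <= K * infl s2.
  rewrite /infl mulr_sumr (le_trans (ler_norm_sum _ _ _))// ler_sum// => j _.
  by rewrite normrM ger0_norm ?pps_p_ge0// mulrCA ler_wpM2l// pps_p_ge0.
have i20 : 0 <= infl s2.
  by apply: sumr_ge0 => j _; rewrite mulr_ge0 ?pps_p_ge0// ltW.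
have E1 : (s1 k.+3).1 i = p k.+2 i i * (s1 k.+2).1 i + infl s1 + (s1 k.+2).2 i.
  by rewrite {1}/s1 /pps_state1 pps_stateS1 big_Nin.
have E2 : (s2 k.+3).1 i = p k.+2 i i * (s2 k.+2).1 i + infl s2 + (s2 k.+2).2 i.
  by rewrite {1}/s2 /pps_state2 pps_stateS1 big_Nin.
have rE k' : (s1 k'.+1).1 i = ratio i k'.+1 * (s2 k'.+1).1 i.
  by have [h _] := pps_state2_ge0 k'; rewrite divfK// gt_eqF.
(* The retained parts p_{ii} x^alpha_{i,l} have exactly the old ratio and cancel. Only inflows and
   x^beta terms remain, each O(e). *)
have -> : ((s2 k.+3).1 i + (s2 k.+3).2 i) * (ratio i k.+3 - ratio i k.+2) =
    infl s1 + (s1 k.+2).2 i - ratio i k.+2 * (infl s2 + (s2 k.+2).2 i) +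
    (s2 k.+3).2 i * (ratio i k.+3 - ratio i k.+2).
  rewrite mulrDl; congr (_ + _).
  by rewrite mulrBr mulrC -rE E1 (rE k.+1) E2; ring.
have r2 := rK _ A1; have r3 := rK _ A2.
set X := (2 * e * (2 * N)%:R) in al1 al2 in2 *.
have -> : (12 * K * (2 * N)%:R + 1) * e = 6 * K * X + e by rewrite /X; ring.
apply: (@le_trans _ _ (6 * K * X)); last by rewrite lerDl ltW.
have -> : 6 * K * X = K * X + K * X + K * (X + X) + X * (K + K) by ring.
rewrite (le_trans (ler_normD _ _))// lerD//; last first.
  rewrite normrM (ger0_norm (b0' i)) ler_pM//.
  by rewrite (le_trans (ler_normB _ _))// lerD.
rewrite (le_trans (ler_normB _ _))// lerD//; last first.
  rewrite normrM ler_pM// ger0_norm ?addr_ge0//.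
  by rewrite lerD.
rewrite (le_trans (ler_normD _ _))// lerD//.
  by rewrite (le_trans in1)// ler_pM2l.
by rewrite (le_trans (B1 i))// ler_pM2l.
Qed.

End Run.
End Dynamics.

(** * The estimator, as a function of the recorded information *)

Section Estimator.
Context {R : realType} {N : nat}.
Variables (E : rel 'I_N) (i j0 : 'I_N).
Implicit Types (o : 'I_N -> nat -> pps_info R N) (f : R * R -> R).

Definition sent_to j o t : R * R := odflt (0, 0) ((o j t).2 i).

(** Here [(o j t).1.1.1.1] is the pair x^alpha_{j,1}(t), x^alpha_{j,2}(t) and [(o j t).1.2 i] is
    p_{ij}(t); taking [f] to be [fst] or [snd] selects l = 1 or 2. *)
Definition net_inflow f o t : R :=
  \sum_(j in Nin E i) (o j t).1.2 i * f (o j t).1.1.1.1 -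
  \sum_(j in Nout E i) f (sent_to j o t).

Definition acc_inflow f o t : R := \sum_(s < t) net_inflow f o s.

Definition seen_ratio o t : R := (sent_to j0 o t).1 / (sent_to j0 o t).2.

(* [2 + acc_inflow snd o t] is the total l = 2 mass of node i at time t. *)
Definition estimate o t : R :=
  ((2 + acc_inflow snd o t) * seen_ratio o t - acc_inflow fst o t) / 2.

Definition width o t : R :=
  `|(2 + acc_inflow snd o t) * (seen_ratio o t - seen_ratio o t.-1)|.

(* For k < 3 the filter is empty and the arg min is the junk value k. *)
Definition best_estimate k o : R :=
  estimate o [arg min_(t < (@ord_max k) | (2 < t)%N) width o t]%O.

Lemma best_estimate_local (A : {set 'I_N}) k :
  j0 \in A -> Nout E i :|: Nin E i \subset A ->
  depends_only_on_info A k (best_estimate k).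
Proof.
move=> j0A /fintype.subsetP sub o o' oo'.
have sentE j t : j \in A -> (t <= k)%N -> sent_to j o t = sent_to j o' t.
  by move=> jA tk; rewrite /sent_to oo'.
have netE f t : (t <= k)%N -> net_inflow f o t = net_inflow f o' t.
  move=> tk; congr (_ - _); apply: eq_bigr => j ji.
    by rewrite oo'//; apply: sub; rewrite finset.inE ji orbT.
  by rewrite sentE//; apply: sub; rewrite finset.inE ji.
have accE f t : (t <= k)%N -> acc_inflow f o t = acc_inflow f o' t.
  by move=> tk; apply: eq_bigr => s _; rewrite netE// ltnW// (leq_trans _ tk).
have ratE t : (t <= k)%N -> seen_ratio o t = seen_ratio o' t.
  by move=> tk; rewrite /seen_ratio sentE.
have estE t : (t <= k)%N -> estimate o t = estimate o' t.
  by move=> tk; rewrite /estimate !accE// ratE.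
have widE : (fun t : 'I_k.+1 => width o t) = (fun t : 'I_k.+1 => width o' t).
  apply/funext => t; have tk : (t <= k)%N by rewrite -ltnS.
  by rewrite /width accE// !ratE// (leq_trans (leq_pred _)).
by rewrite /best_estimate widE estE// -ltnS.
Qed.

(** * Error bound and convergence of the estimator along one run *)

Section Convergence.
Hypotheses (irrE : no_self_loops E) (Ej0i : E j0 i).
Variables (x0 u : 'I_N -> R).
Variables (q : nat -> 'I_N -> 'I_N -> R) (r : nat -> 'I_N -> R).
Hypothesis qpos : forall k j i, (0 < k)%N ->
  j \in Nout E i :|: [set i] -> 0 < q k j i.
Hypothesis rpos : forall k i, (0 < k)%N -> 0 < r k i.
Hypothesis norm0 : pps_norm E q r 0 i != 0.

Let o := pps_obs E x0 u q r.
Let s1 := pps_state1 E x0 u q r.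
Let s2 := pps_state2 E q r.
Let ratio k := (s1 k).1 i / (s2 k).1 i.

Lemma pps_weights_sum_i k : \sum_(j in Nout E i :|: [set i]) pps_p E q r k j i +
  pps_alpha E q r k i = 1.
Proof.
case: k => [|k]; first exact: pps_weights_sum.
by apply: pps_weights_sum; rewrite gt_eqF// (pps_norm_gt0 qpos rpos).
Qed.

Lemma sent_toE j t : E j i -> sent_to j o t =
  (pps_p E q r t j i * (s1 t).1 i, pps_p E q r t j i * (s2 t).1 i).
Proof. by move=> ji; rewrite /sent_to /o /pps_obs /= ffunE inE ji. Qed.

(** Telescoping of [pps_balance] from time 0, where the random [u i] cancels in the total mass. The
    first step uses [norm0], as the l = 1 states need not vanish there. *)
Lemma mass1E t : (s1 t).1 i + (s1 t).2 i = 2 * x0 i + acc_inflow fst o t.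
Proof.
elim: t => [|t IH]; first by rewrite /acc_inflow big_ord0 /=; ring.
rewrite /acc_inflow big_ord_recr /= addrA -[X in _ = X + _]IH.
rewrite /s1 /pps_state1 (pps_balance irrE) ?pps_weights_sum_i ?mul1r//.
congr (_ + (_ - _)); apply: eq_bigr => j ji.
  by rewrite /o /pps_obs /= ffunE.
by rewrite sent_toE//=; rewrite inE in ji.
Qed.

Lemma mass2E t : (s2 t).1 i + (s2 t).2 i = 2 + acc_inflow snd o t.
Proof.
elim: t => [|t IH]; first by rewrite /acc_inflow big_ord0 /=; ring.
rewrite /acc_inflow big_ord_recr /= addrA -[X in _ = X + _]IH.
rewrite /s2 /pps_state2 (pps_balance irrE) ?pps_weights_sum_i ?mul1r//.
congr (_ + (_ - _)); apply: eq_bigr => j ji.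
  by rewrite /o /pps_obs /= ffunE.
by rewrite sent_toE//=; rewrite inE in ji.
Qed.

(** Both messages to [j0] carry the same weight, positive from time 1 on, which cancels. *)
Lemma seen_ratioE t : seen_ratio o t.+1 = ratio t.+1.
Proof.
rewrite /seen_ratio sent_toE//= -mulf_div divff ?mul1r// gt_eqF//.
by apply: (pps_p_gt0 qpos rpos) => //; rewrite !inE Ej0i.
Qed.

(* The two substates of node i at time t+1 have ratios [ratio t.+1] and
   [ratio t], so the mass of node i lies between the two multiples of its
   known l = 2 mass whose difference is the width. *)
Lemma estimate_error t : `|estimate o t.+3 - x0 i| <= width o t.+3.
Proof.
have [a0 b0] := pps_state2_ge0 irrE qpos rpos t.+2.
have [a1 _] := pps_state2_ge0 irrE qpos rpos t.+1.
have rE k : 0 < (s2 k).1 i -> (s1 k).1 i = ratio k * (s2 k).1 i.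
  by move=> h; rewrite divfK// gt_eqF.
have b1E : (s1 t.+3).2 i = ratio t.+2 * (s2 t.+3).2 i.
  rewrite /s1 /s2 /pps_state1 /pps_state2 !pps_stateS2.
  by rewrite mulrCA -rE//; exact: a1.
have := mass1E t.+3; rewrite b1E (rE t.+3) => [h|]; last exact: a0.
have -> : estimate o t.+3 - x0 i =
    (s2 t.+3).2 i * (ratio t.+3 - ratio t.+2) / 2.
  rewrite /estimate -mass2E seen_ratioE.
  have -> : x0 i =
      (2 * x0 i + acc_inflow fst o t.+3 - acc_inflow fst o t.+3) / 2.
    by rewrite addrK mulrC mulKf.
  by rewrite -h -mulrBl; congr (_ / _); ring.
rewrite /width /= -mass2E !seen_ratioE.
rewrite !normrM (ger0_norm (b0 i)) (ger0_norm (addr_ge0 (ltW (a0 i)) (b0 i))).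
rewrite (@ger0_norm _ 2^-1)//.
have := mulr_ge0 (ltW (a0 i)) (normr_ge0 (ratio t.+3 - ratio t.+2)).
have := mulr_ge0 (b0 i) (normr_ge0 (ratio t.+3 - ratio t.+2)).
by rewrite mulrDl => h1 h2; rewrite -/s2 in h1 h2 *; lra.
Qed.

(** The chosen estimate errs by at most its own width, which is the least so far. One narrow width
    therefore serves for all later [k], and a single calm pair per precision suffices for
    convergence. *)
Lemma best_estimate_error k t : (t.+3 <= k)%N ->
  `|best_estimate k o - x0 i| <= width o t.+3.
Proof.
move=> tk; rewrite /best_estimate; case: Order.TotalTheory.arg_minP => /=.
  exact: leq_trans tk.
case=> [[|[|[|s]]] sk]//= _ /(_ (Ordinal (tk : (t.+3 < k.+1)%N)) isT) /= h.
exact: le_trans (estimate_error s) h.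
Qed.

Lemma best_estimate_cvg :
  (forall e : R, 0 < e -> exists k, calm E q r e k.+1 /\ calm E q r e k.+2) ->
  (fun k => best_estimate k o) @ \oo --> x0 i.
Proof.
move=> hcalm; have [K K0 HK] := calm_ratio (x0 := x0) (u := u) irrE qpos rpos.
apply/cvgrPdist_le => e e0.
have [t [c1 c2]] := hcalm (e / K) (divr_gt0 e0 K0).
exists t.+3 => // k /= tk.
rewrite distrC (le_trans (best_estimate_error _ _ tk))//.
rewrite /width -mass2E !seen_ratioE.
by rewrite (le_trans (HK _ _ i c1 c2))// mulrC divfK// gt_eqF.
Qed.

End Convergence.
End Estimator.

(** * Countability of the index type of draws: it supplies decidable equality, and almost sure
    statements for all draws at once *)

Section DrawCountable.
Context {N : nat}.

Definition draw_code (t : pps_draw N) :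
    'I_N + ((nat * 'I_N * 'I_N) + (nat * 'I_N)) :=
  match t with
  | DrawU i => inl i
  | DrawQ k j i => inr (inl (k, j, i))
  | DrawA k i => inr (inr (k, i))
  end.

Definition draw_decode (c : 'I_N + ((nat * 'I_N * 'I_N) + (nat * 'I_N))) :
    pps_draw N :=
  match c with
  | inl i => DrawU i
  | inr (inl (k, j, i)) => DrawQ k j i
  | inr (inr (k, i)) => DrawA k i
  end.

Lemma draw_codeK : cancel draw_code draw_decode.
Proof. by case. Qed.

HB.instance Definition _ := Countable.copy (pps_draw N) (can_type draw_codeK).

End DrawCountable.

Lemma In_mem (I : eqType) (J : seq I) x : List.In x J <-> x \in J.
Proof.
elim: J => //= a J IH; rewrite inE; split.
  by case=> [->|/IH ->]; rewrite ?eqxx ?orbT.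
by move=> /orP[/eqP ->|/IH]; [left|right].
Qed.

Lemma uniq_NoDup (I : eqType) (J : seq I) : uniq J -> List.NoDup J.
Proof.
elim: J => [_|a J IH /= /andP[aJ /IH uJ]]; first exact: List.NoDup_nil.
by apply: List.NoDup_cons => // /In_mem; rewrite (negbTE aJ).
Qed.

(** * Consequences of independence: product rule for cylinders, Borel-Cantelli, concentration of
    sums *)

Section Independence.
Context {R : realType} {d : measure_display} {T : measurableType d}.
Context {P : probability T R} {I : eqType} {D : set I} {X : I -> T -> R}.
Hypothesis indX : mutually_independent P D X.

Definition cylinder (J : seq I) (B : I -> set R) : set T :=
  [set w | forall j, j \in J -> B j (X j w)].

Lemma cylinder_nil B : cylinder [::] B = setT.
Proof. by apply/seteqP; split. Qed.

Lemma cylinder_cat J K B : cylinder (J ++ K) B = cylinder J B `&` cylinder K B.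
Proof.
apply/seteqP; split=> w /=.
  by move=> h; split=> j jJ; apply: h; rewrite mem_cat jJ ?orbT.
by move=> [h1 h2] j; rewrite mem_cat => /orP[/h1|/h2].
Qed.

Lemma cylinder1 x B : cylinder [:: x] B = X x @^-1` B x.
Proof.
apply/seteqP; split=> w /=; first by apply; rewrite mem_head.
by move=> h j; rewrite inE => /eqP ->.
Qed.

Lemma measurable_cylinder J B : (forall j, j \in J -> D j) ->
  (forall j, measurable (B j)) -> measurable (cylinder J B).
Proof.
move=> JD mB; elim: J JD => [|x J IH] JD; first by rewrite cylinder_nil.
rewrite -cat1s cylinder_cat cylinder1; apply: measurableI.
  rewrite -[X in measurable X]setTI; apply: indX.1 => //.
  by apply: JD; rewrite mem_head.
by apply: IH => j jJ; apply: JD; rewrite inE jJ orbT.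
Qed.

Lemma prob_cylinder J B : uniq J -> (forall j, j \in J -> D j) ->
  (forall j, measurable (B j)) ->
  P (cylinder J B) = (\prod_(j <- J) P (X j @^-1` B j))%E.
Proof.
move=> uJ JD mB; rewrite -indX.2//; last exact: uniq_NoDup.
  congr (P _); apply/seteqP; split => w h j /=; first by move/In_mem; exact: h.
  by move=> jJ; apply: (h j); exact/In_mem.
by move=> j /In_mem; exact: JD.
Qed.

Lemma prob_cylinder_cat J K B : uniq (J ++ K) ->
  (forall j, j \in J ++ K -> D j) -> (forall j, measurable (B j)) ->
  P (cylinder (J ++ K) B) = (P (cylinder J B) * P (cylinder K B))%E.
Proof.
move=> uJK JKD mB; rewrite prob_cylinder// big_cat /=.
move: uJK; rewrite cat_uniq => /and3P[uJ _ uK].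
by rewrite !prob_cylinder// => j h; apply: JKD; rewrite mem_cat h ?orbT.
Qed.

(* Second Borel-Cantelli lemma for cylinders over disjoint blocks of indices. *)
Section Blocks.
Variables (J : nat -> seq I) (B : I -> set R) (c : R).
Hypothesis uJ : forall n, uniq (flatten [seq J m | m <- iota 0 n]).
Hypothesis JD : forall m j, j \in J m -> D j.
Hypothesis mB : forall j, measurable (B j).
Hypothesis c01 : 0 < c <= 1.
Hypothesis cJ : forall m, (c%:E <= P (cylinder (J m) B))%E.
Let g m : R := fine (P (cylinder (J m) B)).

Let mJ m : measurable (cylinder (J m) B).
Proof. by apply: measurable_cylinder => // j; exact: JD. Qed.

Let gE m : P (cylinder (J m) B) = (g m)%:E.
Proof. by rewrite fineK// fin_num_measure. Qed.

Let missed n := \big[setI/setT]_(m < n) ~` cylinder (J m) B.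

Let measurable_missed n : measurable (missed n).
Proof. by apply: bigsetI_measurable => m _; exact: measurableC. Qed.

(** Independence is given for cylinders, not for their complements. Keeping a free cylinder over [K]
    makes the induction work: missing block [n] is a difference of two events of the same shape,
    with [K] and with [J n ++ K]. *)
Lemma prob_missed_cylinder n K :
  uniq (flatten [seq J m | m <- iota 0 n] ++ K) -> (forall j, j \in K -> D j) ->
  P (missed n `&` cylinder K B) =
    ((\prod_(m < n) (1 - g m))%:E * P (cylinder K B))%E.
Proof.
elim: n K => [|n IH] K uK KD.
  by rewrite /missed !big_ord0 setTI mul1e.
have mK : measurable (cylinder K B) by exact: measurable_cylinder.
rewrite -addn1 iotaD map_cat flatten_cat /= cats0 -catA in uK.
have uK' : uniq (flatten [seq J m | m <- iota 0 n] ++ K).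
  by apply: subseq_uniq uK; apply: cat_subseq => //; exact: suffix_subseq.
have JKD j : j \in J n ++ K -> D j by rewrite mem_cat => /orP[/JD|/KD].
have uJK : uniq (J n ++ K) by move: uK; rewrite cat_uniq => /and3P[].
have -> : missed n.+1 `&` cylinder K B =
    (missed n `&` cylinder K B) `\` cylinder (J n) B.
  by rewrite /missed big_ord_recr /= setDE -!setIA [X in _ `&` X]setIC.
rewrite measureD//; last 2 first.
- exact: measurableI.
- by rewrite -ge0_fin_numE ?fin_num_measure//; exact: measurableI.
rewrite -setIA [cylinder K B `&` _]setIC -cylinder_cat.
rewrite -[LHS]/(P (missed n `&` cylinder K B) -
  P (missed n `&` cylinder (J n ++ K) B))%E IH// IH//.
rewrite prob_cylinder_cat// gE -[P (cylinder K B)]fineK ?fin_num_measure//.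
by rewrite -!EFinM -EFinB big_ord_recr /=; congr (_%:E); ring.
Qed.

(** The first [n] blocks are all missed with probability at most (1 - c)^n, which tends to 0. *)
Lemma ae_some_block : {ae P, forall w, exists m, cylinder (J m) B w}.
Proof.
exists (\bigcap_m ~` cylinder (J m) B); split.
- by apply: bigcapT_measurable => m; exact: measurableC.
- apply/eqP; rewrite eq_le measure_ge0 andbT.
  apply/lee_addgt0Pr => e e0; rewrite add0e.
  have [c0 c1] := andP c01.
  have : (fun n => (1 - c) ^+ n) @ \oo --> (0 : R).
    by apply: cvg_expr; rewrite ger0_norm ?subr_ge0// ltrBlDr ltrDl.
  move=> /cvgrPdist_lt /(_ _ e0) [n _ /(_ n (leqnn n))].
  rewrite /= sub0r normrN ger0_norm ?exprn_ge0 ?subr_ge0// => hn.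
  apply: (@le_trans _ _ (P (missed n))).
    apply: le_measure; rewrite ?inE//.
      by apply: bigcapT_measurable => m; exact: measurableC.
    rewrite /missed -(bigcap_mkord _ (fun m => ~` cylinder (J m) B)).
    by move=> w h m _; exact: h.
  have := prob_missed_cylinder n [::]; rewrite cats0 cylinder_nil setIT => ->//.
  rewrite probability_setT mule1 lee_fin (le_trans _ (ltW hn))//.
  rewrite -[n in leRHS]card_ord -prodr_const ler_prod// => m _.
  have gc : c <= g m by rewrite -lee_fin -gE.
  rewrite subr_ge0 -lee_fin -gE probability_le1//= lerD2l lerN2//.
- by move=> w /= h m _ hm; apply: h; exists m.
Qed.

End Blocks.

Lemma measurable_sum_itv (J : seq I) a b : (forall j, j \in J -> D j) ->
  measurable [set w | a <= \sum_(j <- J) X j w <= b].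
Proof.
move=> JD; pose S w := \sum_(j <- J) X j w.
have mS : measurable_fun setT S.
  rewrite /S; elim: J JD {S} => [|x J IH] JD.
    by under eq_fun do rewrite big_nil; exact: measurable_cst.
  under eq_fun do rewrite big_cons.
  apply: measurable_funD; first by apply: indX.1; apply: JD; rewrite mem_head.
  by apply: IH => j jJ; apply: JD; rewrite inE jJ orbT.
have -> : [set w | a <= \sum_(j <- J) X j w <= b] = S @^-1` `[a, b].
  by apply/seteqP; split=> w; rewrite /= in_itv.
by rewrite -[X in measurable X]setTI; exact: mS.
Qed.

(* The concentration function of a sum is controlled by that of one
   independent summand: slice the range of another summand in cells of width
   e, which at most doubles the width of the window left to the rest. *)
Lemma prob_sum_itv (y : I) (C : R) (J : seq I) : 0 <= C ->
  (forall a e : R, 0 < e ->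
    (P (X y @^-1` `[a, (a + e)%R]%classic) <= (C * e)%:E)%E) ->
  forall (K : seq I) (B : I -> set R) (a e : R), 0 < e -> uniq (y :: J ++ K) ->
    (forall j, j \in y :: J ++ K -> D j) -> (forall j, measurable (B j)) ->
  (P ([set w | (a <= \sum_(j <- y :: J) X j w <= a + e)%R] `&` cylinder K B)
    <= P (cylinder K B) * (C * 2 ^+ size J * e)%:E)%E.
Proof.
move=> C0 hy; elim: J => [|x J IH] K B a e e0 uJ JD mB.
  (* With one summand left, the window is itself a constraint on coordinate [y]; as [y] is not in
     [K], it joins the cylinder. *)
  pose B' k := if k == y then `[a, a + e]%classic else B k.
  have B'K : cylinder K B = cylinder K B'.
    apply/seteqP; split => w h j jK; have := h j jK; rewrite /B';
    by case: eqP => // jy; move: uJ; rewrite -jy /= jK.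
  have mB' j : measurable (B' j) by rewrite /B'; case: ifP.
  have -> : [set w | a <= \sum_(j <- [:: y]) X j w <= a + e] =
      cylinder [:: y] B'.
    rewrite cylinder1 /B' eqxx; apply/seteqP.
    by split=> w /=; rewrite big_seq1 in_itv.
  rewrite setIC B'K setIC -cylinder_cat prob_cylinder_cat//= muleC lee_pmul//.
  by rewrite cylinder1 /B' eqxx expr0 mulr1 hy.
(* In the induction step [x] moves from the sum to the cylinder, where it is confined to one
   cell. *)
have pm : perm_eq (y :: J ++ x :: K) (y :: (x :: J) ++ K).
  by rewrite perm_cons -[x :: K]cat1s perm_catCA.
have uJ' : uniq (y :: J ++ x :: K) by rewrite (perm_uniq pm).
have JD' j : j \in y :: J ++ x :: K -> D j by rewrite (perm_mem pm); exact: JD.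
have xK : x \notin K by move: uJ'; rewrite /= cat_uniq /= => /and5P[].
have xKD j : j \in x :: K -> D j.
  by move=> h; apply: JD'; rewrite inE mem_cat h !orbT.
pose cell (z : int) := `[z%:~R * e, (z + 1)%:~R * e[%classic : set R.
(* Cells are enumerated by codes of integers. Where [n] codes no integer, the default 0 is harmless
   since [cell' n] is empty. *)
pose z_ n := odflt 0 (@pickle_inv int n).
pose cell' n := if @pickle_inv int n is Some z then cell z else set0.
pose B' n k := if k == x then cell' n else B k.
have mcell n : measurable (cell' n).
  by rewrite /cell' /cell; case: (pickle_inv _) => [z|].
have mB' n j : measurable (B' n j) by rewrite /B'; case: ifP.
have cylE n : cylinder (x :: K) (B' n) = X x @^-1` cell' n `&` cylinder K B.
  rewrite -cat1s cylinder_cat cylinder1 /B' eqxx; congr (_ `&` _).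
  apply/seteqP; split => w h j jK; have := h j jK;
  by case: eqP => // jx; move: xK; rewrite -jx jK.
have mK : measurable (cylinder K B).
  by apply: measurable_cylinder => // j jK; apply: xKD; rewrite inE jK orbT.
have mcyl n : measurable (cylinder (x :: K) (B' n)).
  exact: measurable_cylinder.
have cell_uniq n v : cell' n v -> n = pickle (Num.floor (v / e)).
  rewrite /cell'; have := @pickle_invK int n; case: pickle_inv => //= z <-.
  rewrite /cell /= in_itv /= => /andP[h1 h2]; congr pickle.
  apply/esym/floor_def.
  by rewrite ler_pdivlMr// ltr_pdivrMr// h1 h2.
have tcyl : trivIset setT (fun n => cylinder (x :: K) (B' n)).
  apply/trivIsetP => m n _ _; apply: contraNeq => /set0P[w []].
  rewrite !cylE => -[/= /cell_uniq -> _] [/= /cell_uniq -> _]; exact: eqxx.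
pose win (a e : R) := [set w | a <= \sum_(j <- y :: J) X j w <= a + e].
have mwin a' e' : measurable (win a' e').
  apply: measurable_sum_itv => j jJ; apply: JD'.
  by move: jJ; rewrite !inE mem_cat => /orP[->|->]; rewrite ?orbT.
(* If [X x] lies in [z e, (z + 1) e), the other summands add up to a value between a - (z + 1) e and
   a + e - z e, a window of width 2 e. *)
pose A n := win (a - (z_ n + 1)%:~R * e) (2 * e) `&` cylinder (x :: K) (B' n).
have mA n : measurable (A n) by exact: measurableI.
set W := [set w | _].
have mW : measurable W.
  apply: measurable_sum_itv => j jJ; apply: JD.
  by move: jJ; rewrite !inE mem_cat => /or3P[->|->|->]; rewrite ?orbT.
have WA : W `&` cylinder K B `<=` \bigcup_n A n.
  move=> w [Ww Kw]; pose z := Num.floor (X x w / e).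
  have zE : @pickle_inv int (pickle z) = Some z by exact: pickleK_inv.
  have h1 : z%:~R * e <= X x w by rewrite -ler_pdivlMr// floor_le.
  have h2 : X x w < (z + 1)%:~R * e by rewrite -ltr_pdivrMr// floorD1_gt.
  exists (pickle z) => //; split.
    rewrite /win /= /z_ zE /=; move: Ww; rewrite /W /= !big_cons.
    rewrite intrD mulrDl mul1r in h2 *.
    by move=> /andP[h3 h4]; apply/andP; split; lra.
  by rewrite cylE /cell' zE /cell; split=> //=; rewrite in_itv /= h1 h2.
apply: (le_trans (measure_sigma_subadditive _ _ _ WA)) => //.
  exact: measurableI.
apply: (@le_trans _ _ (\sum_(n <oo) ((C * 2 ^+ size (x :: J) * e)%:E *
    P (cylinder (x :: K) (B' n))))%E).
  apply: lee_nneseries => // n _; rewrite muleC.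
  rewrite [size _]/= exprS.
  have -> : C * (2 * 2 ^+ size J) * e = C * 2 ^+ size J * (2 * e) by ring.
  by apply: IH => //; rewrite mulr_gt0.
(* The cells are disjoint, so their cylinders sum to at most the probability of the cylinder over
   [K]. *)
rewrite nneseriesZl// -measure_semi_bigcup//; last exact: bigcupT_measurable.
rewrite muleC lee_pmul//; first by rewrite lee_fin !mulr_ge0// ?exprn_ge0// ltW.
apply: le_measure; rewrite ?inE//; first exact: bigcupT_measurable.
by move=> w [n _]; rewrite cylE => -[].
Qed.

End Independence.

(** * Interval probabilities of uniform and normal draws *)

Section Densities.
Context {R : realType} {d : measure_display} {T : measurableType d}.
Context {P : probability T R}.
Local Notation mu := lebesgue_measure.

Lemma uniform01_itv (X : T -> R) a b : has_density P X (uniform_pdf 0 1) ->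
  0 <= a <= b -> b <= 1 -> P (X @^-1` `[a, b]) = (b - a)%:E.
Proof.
move=> dX /andP[a0 ab] b1; rewrite dX// (eq_integral (cst 1%E)) => [|x].
  rewrite integral_cst//= mul1e lebesgue_measure_itv /= lte_fin.
  by case: ltgtP ab => // -> _; rewrite subrr.
rewrite inE /= in_itv /= => /andP[ax xb].
by rewrite /uniform_pdf (le_trans a0 ax) (le_trans xb b1) subr0 invr1.
Qed.

Lemma uniform01_gt0 (X : T -> R) : measurable_fun setT X ->
  has_density P X (uniform_pdf 0 1) -> {ae P, forall w, 0 < X w}.
Proof.
move=> mX dX; exists (X @^-1` `]-oo, 0]); split.
- by rewrite -[X in measurable X]setTI; exact: mX.
- rewrite dX// integral_uniform_pdf.
  have -> : `]-oo, 0%R] `&` `[0%R, 1%R] = `[0%R, 0%R]%classic :> set R.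
    apply/seteqP; split=> x /=; rewrite !in_itv /=.
      by case=> -> /andP[->].
    by move=> /andP[x0 x0']; rewrite x0 x0' (le_trans x0').
  by rewrite -dX// uniform01_itv ?lexx// subrr.
- by move=> w /= /negP; rewrite -leNgt in_itv.
Qed.

Lemma normal_itv_le (X : T -> R) (s a e : R) : s != 0 ->
  has_density P X (normal_pdf 0 s) -> 0 < e ->
  (P (X @^-1` `[a, (a + e)%R]%classic) <= (normal_peak s * e)%:E)%E.
Proof.
move=> s0 dX e0; rewrite dX//.
apply: (@le_trans _ _ (\int[mu]_(x in `[a, (a + e)%R]) (normal_peak s)%:E)%E).
  apply: ge0_le_integral => //.
  - by move=> x _; rewrite lee_fin normal_pdf_ge0.
  - apply: measurable_funTS; apply: measurableT_comp => //.
    exact: measurable_normal_pdf.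
  - by move=> x _; rewrite lee_fin normal_pdf_ub.
rewrite integral_cst//= lebesgue_measure_itv /= lte_fin ltrDl e0.
by rewrite -EFinD -EFinM addrAC subrr add0r.
Qed.

End Densities.

(** * Blocks of draws, and the ranges that make a step calm *)

Section CalmDraws.
Context {N : nat} (E : rel 'I_N).

Definition draws_at (k : nat) : seq (pps_draw N) :=
  [seq DrawA k j | j <- enum 'I_N] ++
  [seq DrawQ k jl.1 jl.2 | jl <- enum [pred jl : 'I_N * 'I_N |
                                        jl.1 \in Nout E jl.2 :|: [set jl.2]]].

Definition draw_time (t : pps_draw N) : nat :=
  match t with DrawU _ => 0 | DrawQ k _ _ => k | DrawA k _ => k end.

Lemma draws_at_time k t : t \in draws_at k -> draw_time t = k.
Proof. by rewrite mem_cat => /orP[] /mapP[x _ ->]. Qed.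

Lemma draws_at_dom k t : t \in draws_at k -> pps_draw_dom E t.
Proof.
by rewrite mem_cat => /orP[] /mapP[x + ->]//=; rewrite mem_enum.
Qed.

Lemma draws_at_uniq k : uniq (draws_at k).
Proof.
have injA : injective (@DrawA N k) by move=> a a' [->].
have injQ : injective (fun jl : 'I_N * 'I_N => DrawQ k jl.1 jl.2).
  by move=> [a b] [a' b'] [-> ->].
rewrite cat_uniq (map_inj_uniq injA) (map_inj_uniq injQ) !enum_uniq andbT /=.
by apply/hasPn => t /mapP[x _ ->]; apply/mapP => -[].
Qed.

Lemma DrawA_at k j : DrawA k j \in draws_at k.
Proof. by rewrite mem_cat map_f ?mem_enum. Qed.

Lemma DrawQ_at k j l : j \in Nout E l :|: [set l] -> DrawQ k j l \in draws_at k.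
Proof.
move=> h; rewrite mem_cat; apply/orP; right.
by apply/mapP; exists (j, l) => //; rewrite mem_enum.
Qed.

(** Disjoint pairs of consecutive times, starting at 1 so that only draws from U(0,1) occur. *)
Definition draw_block (m : nat) := draws_at m.*2.+1 ++ draws_at m.*2.+2.

Lemma draw_block_time m t : t \in draw_block m -> (draw_time t).-1./2 = m.
Proof.
rewrite mem_cat => /orP[] /draws_at_time -> /=; first exact: doubleK.
by rewrite uphalf_double.
Qed.

Lemma draw_blocks_uniq a n :
  uniq (flatten [seq draw_block m | m <- iota a n]).
Proof.
elim: n a => [//|n IH] a /=; rewrite cat_uniq IH andbT; apply/andP; split.
  rewrite cat_uniq !draws_at_uniq andbT; apply/hasPn => t /draws_at_time ht.
  apply/negP => /draws_at_time; rewrite ht => /eqP.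
  by rewrite (gtn_eqF (ltnSn _)).
apply/hasPn => t /flatten_mapP[m]; rewrite mem_iota => /andP[am _].
move=> /draw_block_time ht; apply/negP => /draw_block_time; rewrite ht => ma.
by rewrite ma ltnn in am.
Qed.

Lemma size_draw_block m : size (draw_block m) = size (draw_block 0).
Proof. by rewrite /draw_block /draws_at !size_cat !size_map. Qed.

(** For e <= 1/2 each range is an interval inside [0,1] of length at least e. The value at [DrawU]
    is a filler, as no block contains such a draw. *)
Definition calm_range {R : realType} (e : R) (t : pps_draw N) : set R :=
  if t is DrawQ _ j l
  then if j == l then `[2^-1, 1]%classic else `[0, e]%classic
  else `[0, e]%classic.

End CalmDraws.

(** * Almost sure properties of the probabilistic model *)

Section Model.
Context {R : realType} {N : nat} {E : rel 'I_N} {M : R}.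
Hypotheses (irrE : no_self_loops E) (M0 : 0 < M).
Context {d : measure_display} {T : measurableType d} {P : probability T R}.
Context {u : 'I_N -> T -> R} {q : nat -> 'I_N -> 'I_N -> T -> R}.
Context {r : nat -> 'I_N -> T -> R}.
Hypothesis model : pps_model P E M u q r.
Let X := pps_draw_fam u q r.

Lemma pps_draws_indep : mutually_independent P (pps_draw_dom E) X.
Proof. by case: model. Qed.

Lemma pps_draw_uniform t : (0 < draw_time t)%N -> pps_draw_dom E t ->
  has_density P (X t) (uniform_pdf 0 1).
Proof.
case: model => _ _ hq hr _.
by case: t => //= [k j l|k j] k0 h; [exact: hq|exact: hr].
Qed.

Lemma ae_draws_gt0 : {ae P, forall w t, (0 < draw_time t)%N ->
  pps_draw_dom E t -> 0 < X t w}.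
Proof.
(* Quantifying over codes reduces the claim to countably many null sets. *)
have : {ae P, forall w, forall n, forall t, unpickle n = Some t ->
    (0 < draw_time t)%N -> pps_draw_dom E t -> 0 < X t w}.
  apply: ae_foralln => n; case: (unpickle n) => [t|]; last exact: aeW.
  have [tD|tD] := pselect ((0 < draw_time t)%N /\ pps_draw_dom E t); last first.
    by apply: aeW => w _ [<-] h1 h2; case: tD.
  have [h1 h2] := tD.
  have := uniform01_gt0 _ (pps_draws_indep.1 _ h2) (pps_draw_uniform _ h1 h2).
  by apply: filterS => w hw _ [<-].
by apply: filterS => w h t; apply: (h (pickle t)); exact: pickleK.
Qed.

(** The raw alpha_i(0) has a bounded density, so by [prob_sum_itv] the sum falls in [0, e / C] with
    probability at most e, for every e > 0. *)
Lemma ae_norm_neq0 i : {ae P, forall w,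
  pps_norm E (fun t j l => q t j l w) (fun t j => r t j w) 0 i != 0}.
Proof.
have sM : Num.sqrt M != 0 by rewrite gt_eqF// sqrtr_gt0.
pose J := [seq DrawQ 0 j i | j <- enum (Nout E i :|: [set i])].
pose y := DrawA 0 i.
have normE w : \sum_(j <- y :: J) X j w =
    pps_norm E (fun t j l => q t j l w) (fun t j => r t j w) 0 i.
  by rewrite big_cons big_map big_enum /= addrC.
have uJ : uniq (y :: J ++ [::]).
  rewrite cats0 /= map_inj_uniq ?enum_uniq ?andbT; last by move=> a b [].
  by apply/mapP => -[].
have JD j : j \in y :: J ++ [::] -> pps_draw_dom E j.
  by rewrite cats0 inE => /orP[/eqP ->//|/mapP[a + ->]]; rewrite mem_enum.
pose Z e := [set w | 0 <= \sum_(j <- y :: J) X j w <= e].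
have mZ e : measurable (Z e).
  apply: (measurable_sum_itv pps_draws_indep) => j jJ.
  by apply: JD; rewrite cats0.
exists (Z 0); split=> //.
- apply/eqP; rewrite eq_le measure_ge0 andbT; apply/lee_addgt0Pr => e e0.
  pose C := normal_peak (Num.sqrt M) * 2 ^+ size J.
  have C0 : 0 < C by rewrite mulr_gt0 ?exprn_gt0// normal_peak_gt0.
  apply: (@le_trans _ _ (P (Z (e / C)))).
    apply: le_measure; rewrite ?inE; [exact: mZ..|].
    move=> w /andP[h1 h2]; apply/andP; split=> //.
    by rewrite (le_trans h2)// divr_ge0// ltW.
  have hy (a e' : R) : 0 < e' ->
      (P (X y @^-1` `[a, (a + e')%R]%classic) <=
        (normal_peak (Num.sqrt M) * e')%:E)%E.
    by apply: normal_itv_le => //; case: model => _ [_ h] _ _ _; exact: h.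
  have := prob_sum_itv pps_draws_indep _ _ _ (normal_peak_ge0 _) hy [::]
    (fun=> setT) 0 (e / C) (divr_gt0 e0 C0) uJ JD (fun=> measurableT).
  rewrite cylinder_nil setIT probability_setT mul1e add0r add0e.
  by rewrite -/C [C * _]mulrC divfK// gt_eqF.
- by move=> w /= /negP; rewrite negbK -normE => /eqP h; rewrite /Z /= h lexx.
Qed.

Lemma ae_calm e : 0 < e <= 2^-1 -> {ae P, forall w, exists k,
  calm E (fun t j l => q t j l w) (fun t j => r t j w) e k.+1 /\
  calm E (fun t j l => q t j l w) (fun t j => r t j w) e k.+2}.
Proof.
move=> /andP[e0 e2]; have e1 : e <= 1 by lra.
pose B := @calm_range N R e.
have mB t : measurable (B t).
  by rewrite /B; case: t => //= [_ j l]; case: ifP.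
have JD m t : t \in draw_block E m -> pps_draw_dom E t.
  by rewrite mem_cat => /orP[] /draws_at_dom.
have Jt m t : t \in draw_block E m -> (0 < draw_time t)%N.
  by rewrite mem_cat => /orP[] /draws_at_time ->.
have Bt m t : t \in draw_block E m -> (e%:E <= P (X t @^-1` B t))%E.
  move=> tm; have dt := pps_draw_uniform _ (Jt _ _ tm) (JD _ _ tm).
  have h : P (X t @^-1` `[0, e]) = e%:E.
    by rewrite uniform01_itv ?subr0// lexx ltW.
  case: t dt h {tm} => [j|k j l|k j] dt h; rewrite /B /= ?h//.
  case: ifP => _; rewrite ?h// uniform01_itv ?lee_fin//; first by lra.
  by apply/andP; split; lra.
(* All blocks have the same number of draws, each calm with probability at least e; this gives a
   lower bound independent of the block. *)
have c01 : 0 < e ^+ size (draw_block E 0) <= 1.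
  by rewrite exprn_gt0//= exprn_ile1// ltW.
have cJ m : ((e ^+ size (draw_block E 0))%:E <=
    P (cylinder (X := X) (draw_block E m) B))%E.
  rewrite (prob_cylinder pps_draws_indep)//; last 2 first.
    by have := draw_blocks_uniq E m 1; rewrite /= cats0.
    exact: JD.
  rewrite -(size_draw_block E m); move: (Bt m); elim: draw_block => [|t s IH] h.
    by rewrite big_nil.
  rewrite big_cons /= exprS EFinM; apply: lee_pmul.
  - by rewrite lee_fin ltW.
  - by rewrite lee_fin exprn_ge0// ltW.
  - by apply: h; rewrite mem_head.
  - by apply: IH => t' h'; apply: h; rewrite inE h' orbT.
have := ae_some_block pps_draws_indep _ _ _ (draw_blocks_uniq E 0) JD mB c01 cJ.
apply: filterS => w [m hm]; exists m.*2.
have calmP k : (forall t, t \in draws_at E k -> B t (X t w)) ->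
    calm E (fun t j l => q t j l w) (fun t j => r t j w) e k.
  move=> h j; split.
  - have := h _ (DrawQ_at E k j j _); rewrite /B /calm_range eqxx /= in_itv /=.
    by move=> /(_ _)/andP[]//; rewrite !inE eqxx orbT.
  - have := h _ (DrawA_at E k j).
    by rewrite /B /calm_range /= in_itv /= => /andP[].
  - move=> l lj; have := h _ (DrawQ_at E k l j _); rewrite inE lj => /(_ isT).
    rewrite /B /calm_range; case: eqP => [lj'|_]; last first.
      by rewrite /= in_itv /= => /andP[].
    by move: lj; rewrite lj' Nout_self.
by split; apply: calmP => t ht; apply: hm; rewrite mem_cat ht ?orbT.
Qed.

End Model.

(** * Existence of an out-neighbour, and assembly of the result *)

Lemma strongly_connected_Nout N (E : rel 'I_N) i : (1 < N)%N ->
  strongly_connected E -> exists j, E j i.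
Proof.
move=> N1 sc.
have [v vi] : exists v : 'I_N, v != i.
  have /card_gt0P[v] : (0 < #|predC1 i|)%N.
    by rewrite cardC1 card_ord -subn1 subn_gt0.
  by exists v.
have /connectP[[|j s] /=] := sc i v.
  by move=> _ vE; rewrite vE eqxx in vi.
by move=> /andP[ji _] _; exists j.
Qed.

Theorem theorem3 (R : realType) (N : nat) (E : rel 'I_N) (M : R)
    (A : {set 'I_N}) (i : 'I_N) :
  (2 < N)%N -> no_self_loops E -> strongly_connected E -> 0 < M ->
  i \notin A -> Nout E i :|: Nin E i \subset A ->
  exists F : nat -> ('I_N -> nat -> pps_info R N) -> R,
    (forall k, depends_only_on_info A k (F k)) /\
    forall (x0 : 'I_N -> R) (d : measure_display) (T : measurableType d)
      (P : probability T R) (u : 'I_N -> T -> R)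
      (q : nat -> 'I_N -> 'I_N -> T -> R) (r : nat -> 'I_N -> T -> R),
      pps_model P E M u q r ->
      {ae P, forall w,
        (fun k => F k (pps_obs E x0 (fun j => u j w) (fun t j l => q t j l w)
                          (fun t j => r t j w))) @ \oo --> x0 i}.
Proof.
move=> N2 irrE sc M0 _ sub.
(* The out-neighbour [j0] belongs to [A] and is the one through which the ratio of [i] is read. *)
have [j0 j0i] := strongly_connected_Nout _ _ i (ltnW N2) sc.
exists (best_estimate E i j0); split.
  move=> k; apply: best_estimate_local => //.
  by apply: (fintype.subsetP sub); rewrite !finset.inE j0i.
move=> x0 d T P u q r model.
(* Countably many precisions suffice; 1/(n + 2) is at most 1/2, as [ae_calm] requires. *)
have hcalm : {ae P, forall w, forall n, exists k,
    calm E (fun t j l => q t j l w) (fun t j => r t j w) n.+2%:R^-1 k.+1 /\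
    calm E (fun t j l => q t j l w) (fun t j => r t j w) n.+2%:R^-1 k.+2}.
  apply: ae_foralln => n; apply: (ae_calm irrE model).
  by rewrite invr_gt0 ltr0n /= lef_pV2 ?posrE// ler_nat.
apply: filterS3 hcalm (ae_draws_gt0 model) (ae_norm_neq0 M0 model i).
move=> w hc hpos hn; apply: best_estimate_cvg => //.
- by move=> k j l k0 jl; apply: (hpos (DrawQ k j l)).
- by move=> k l k0; apply: (hpos (DrawA k l)).
- move=> e e0; have [k [c1 c2]] := hc (Num.bound e^-1).
  exists k; have le : (Num.bound e^-1).+2%:R^-1 <= e.
    rewrite invf_ple ?posrE// (le_trans (ltW (archi_boundP _)))//.
      by rewrite invr_ge0 ltW.
    by rewrite ler_nat -addn2 leq_addr.
  have mono k' : calm E (fun t j l => q t j l w) (fun t j => r t j w)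
      (Num.bound e^-1).+2%:R^-1 k' ->
      calm E (fun t j l => q t j l w) (fun t j => r t j w) e k'.
    move=> h j; have [h1 h2 h3] := h j.
    by split=> // [|l lj]; [exact: le_trans h2 le|exact: le_trans (h3 l lj) le].
  by split; exact: mono.
Qed.
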